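(* Let $P=(p_1,p_2,\dots)$ and $Q=(q_1,q_2,\dots)$ be properly arranged sequences which are not comparable (neither $P\le Q$ nor $Q\le P$), and let $\sum_{(P,Q)}$ be the $2$-solenoid of the sequence of matrices $\big(\mathrm{diag}(p_j,q_j)\big)_{j\ge1}$. Whenever two linear flows $\Phi^{\mathbf\omega}$ and $\Phi^{\mathbf\omega'}$ on $\sum_{(P,Q)}$ ($\mathbf\omega,\mathbf\omega'\in\mathbb R^2-\{\mathbf 0\}$) are equivalent, there is a matrix $A=\begin{pmatrix}a&0\\0&d\end{pmatrix}$, where $a$ is a $(P)$ iso-multiplier and $d$ is a $(Q)$ iso-multiplier, such that $A$ represents an automorphism $A_{(P,Q)}$ of $\sum_{(P,Q)}$ and $\alpha\times A_{(P,Q)}$ is an equivalence from $\Phi^{\mathbf\omega}$ to $\Phi^{\mathbf\omega'}$ for some increasing continuous homomorphism $\alpha:\mathbb R\to\mathbb R$.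
   Context: All homomorphisms of topological groups are continuous. $S^1=\mathbb R/\mathbb Z$, $\mathbf T^n=\prod_{i=1}^nS^1$, $p^n:\mathbb R^n\to\mathbf T^n$ is coordinatewise reduction mod $1$. $n$-solenoid: for a sequence $\overline M=(M_1,M_2,\dots)$ of $n\times n$ integer matrices with non-zero determinants, $\sum_{\overline M}=\{(\mathbf x^j)_{j\ge1}\in\prod_{j=1}^\infty\mathbf T^n:\mathbf x^j=f_j^{j+1}(\mathbf x^{j+1})\ \forall j\}$, where $f_j^{j+1}\circ p^n=p^n\circ M_j$; it is a topological group. $\pi_{\overline M}:\mathbb R^n\to\sum_{\overline M}$ is $\mathbf t\mapsto(p^n(\mathbf t),p^n(M_1^{-1}\mathbf t),\dots,p^n(M_j^{-1}\cdots M_1^{-1}\mathbf t),\dots)$. A matrix $A$ represents an automorphism $h$ of $\sum_{\overline M}$ if $h\circ\pi_{\overline M}=\pi_{\overline M}\circ A$ (such $h$ is unique; here it is denoted $A_{(P,Q)}$). For a sequence $P=(p_1,p_2,\dots)$ of non-zero integers, $\sum_P$, $\pi_P$ denote the case $n=1$, $M_j=(p_j)$; $\mathbf C_P=\pi_P(\mathbb R)$ is the path component of the identity of $\sum_P$, with the subspace topology. Linear flows: for $\mathbf\omega\neq\mathbf 0$, $\Phi^{\mathbf\omega}(t,x)=\pi_{\overline M}(t\mathbf\omega)+x$. Equivalence: flows $\phi$ on $X$ and $\psi$ on $Y$ are equivalent if there are an increasing homomorphism $\alpha:\mathbb R\to\mathbb R$ and a homeomorphism $h:X\to Y$ with $h(\phi(t,x))=\psi(\alpha(t),h(x))$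 for all $t,x$; then $\alpha\times h$ is called an equivalence from $\phi$ to $\psi$. Multipliers: for $r\in\mathbb R$ define $r^{P\to Q}:\mathbf C_P\to\mathbf C_Q$ by $r^{P\to Q}(\pi_P(s))=\pi_Q(rs)$ for $s\in\mathbb R$ if $P$ is not eventually $1$; if $P$ is eventually $1$ and $p$ is the product of all its terms, then $\pi_P:[0,p)\to\mathbf C_P$ is a bijection and $r^{P\to Q}(\pi_P(s))=\pi_Q(rs)$ for $s\in[0,p)$. $r$ is a proper $P\to Q$ multiplier if $r^{P\to Q}$ is a continuous homomorphism; $r$ is a $(P)$ iso-multiplier if $r$ and $\frac1r$ are proper $P\to P$ multipliers. Order and proper arrangement. The derived sequence $P'$ of a sequence $P$ of non-zero integers is the sequence of primes and $1$'s obtained by replacing successively each $|p_i|$ by its prime factors (with multiplicity) in order of magnitude, each term with $|p_i|=1$ being replaced by $1$. For a prime $q$, $card_q(P')$ is the number (possibly $\infty$) of occurrences of $q$ in $P'$. $P\le Q$ means: finitely many terms may be deleted from $P'$ so that each prime occurring in the resulting sequence occurs in $Q'$ with the same or greater cardinality. Let $f_0(k,i)=\frac{(k+i-2)(k+i-1)}2+i$, a bijection $\mathbb N\times\mathbb N\to\mathbb N$, $\mathbb N=\{1,2,\dots\}$. The proper arrangement of $P_1,\dots,P_n$ is the list $Q_1=(q^1_1,q^1_2,\dots),\dots,Q_n=(q^n_1,q^n_2,\dots)$ defined as follows, separately for each $k\in\mathbb N$, where $\ell_k$ is the $k$-th prime. Start with $J=\{1,\dots,n\}$. Let $\mu=\max\{card_{\ell_k}(P_j'):j\in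 J\}$ and $m=\min\{j\in J:card_{\ell_k}(P_j')=\mu\}$. Set $q^m_{f_0(k,i)}=\ell_k$ for $i\le\mu$ and $q^m_{f_0(k,i)}=1$ for $i>\mu$. For every $j\in J$ with $P_m\le P_j$ set $q^j_{f_0(k,i)}=q^m_{f_0(k,i)}$ for all $i$. Remove from $J$ the indices now treated and repeat until $J$ is empty. Sequences $P_1,\dots,P_n$ are properly arranged if they equal their proper arrangement; here this is applied to the pair $P,Q$. *)

(* Defs.v *)
From HB Require Import structures.
From mathcomp Require Import all_boot all_order all_algebra.
From mathcomp Require Import all_classical all_reals all_analysis.

Set Implicit Arguments.
Unset Strict Implicit.
Unset Printing Implicit Defensive.

Import Order.TTheory GRing.Theory Num.Theory.
Import numFieldNormedType.Exports.
Local Open Scope classical_set_scope.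
Local Open Scope ring_scope.
Local Open Scope quotient_scope.

(* All sequences are indexed from 0: the term with index j >= 1 in the usual
   numbering is the value at j.-1. *)

Record nzseq := NZSeq {
  nzseq_val :> nat -> int ;
  nzseq_neq0 : forall j, nzseq_val j != 0 }.

Record nzmxseq (n : nat) := NZMxSeq {
  nzmxseq_val :> nat -> 'M[int]_n ;
  nzmxseq_det : forall j, \det (nzmxseq_val j) != 0 }.

Section Circle.
Variable R : realType.

Definition int_zmod : zmodClosed R :=
  GRing.ZmodClosed.clone R (@Num.int_num_subdef R) _.

(* R / Z as a quotient group, with the quotient topology. *)
Definition circle : Type :=
  quotient_topology (Quotient.quot int_zmod).

HB.instance Definition _ := Topological.on circle.
HB.instance Definition _ := GRing.Zmodule.copy circle
  (Quotient.quot int_zmod).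

Definition circle_pi (x : R) : circle :=
  \pi_(Quotient.quot int_zmod) x.

Lemma circle_pi_zmod : zmod_morphism circle_pi.
Proof. by move=> x y; rewrite /circle_pi; exact: raddfB. Qed.
HB.instance Definition _ :=
  GRing.isZmodMorphism.Build R circle circle_pi circle_pi_zmod.
End Circle.

Section Solenoid.
Variables (R : realType) (n : nat).

Definition torus_pi (t : 'cV[R]_n) : 'cV[circle R]_n := map_mx (@circle_pi R) t.

Lemma torus_pi_zmod : zmod_morphism torus_pi.
Proof. by move=> s t; apply/matrixP => i j; rewrite !mxE raddfB. Qed.
HB.instance Definition _ :=
  GRing.isZmodMorphism.Build 'cV[R]_n 'cV[circle R]_n torus_pi torus_pi_zmod.

(* The endomorphism of the torus induced by the integer matrix M, see
   [torus_mapE]. *)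
Definition torus_map (M : 'M[int]_n) (x : 'cV[circle R]_n) : 'cV[circle R]_n :=
  \col_i \sum_k x k 0 *~ M i k.

Lemma torus_map_zmod M : zmod_morphism (torus_map M).
Proof.
move=> x y; apply/matrixP => i j; rewrite !mxE -sumrB; apply: eq_bigr => k _.
by rewrite !mxE mulrzBl.
Qed.
HB.instance Definition _ M :=
  GRing.isZmodMorphism.Build 'cV[circle R]_n 'cV[circle R]_n
    (torus_map M) (torus_map_zmod M).

Lemma torus_mapE M t :
  torus_map M (torus_pi t) = torus_pi (map_mx intr M *m t).
Proof.
apply/matrixP => i j; rewrite !mxE (raddf_sum (@circle_pi R)).
apply: eq_bigr => k _; rewrite !mxE ord1 -raddfMz.
by congr circle_pi; rewrite mulrzl.
Qed.

Definition torus_seq : Type := prod_topology (fun _ : nat => 'cV[circle R]_n).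
HB.instance Definition _ := Topological.on torus_seq.
HB.instance Definition _ := GRing.Zmodule.copy torus_seq (nat -> 'cV[circle R]_n).

Variable M : nzmxseq n.

Definition in_solenoid (x : torus_seq) : bool :=
  `[< forall j, x j = torus_map (M j) (x j.+1) >].

Lemma in_solenoid_zmod_closed : zmod_closed in_solenoid.
Proof.
split=> [|x y /asboolP Mx /asboolP My]; apply/asboolP => j.
  by rewrite [RHS](raddf0 (torus_map (M j))).
transitivity (x j - y j) => //.
by rewrite Mx My -(raddfB (torus_map (M j))).
Qed.

Definition solenoid : Type := {x : torus_seq | in_solenoid x}.
HB.instance Definition _ := SubChoice.on solenoid.
HB.instance Definition _ :=
  GRing.SubChoice_isSubZmodule.Build torus_seq in_solenoid solenoid
    in_solenoid_zmod_closed.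
HB.instance Definition _ := Topological.copy solenoid
  (initial_topology (\val : solenoid -> torus_seq)).

(* pull j t is M_j^-1 *m ... *m M_1^-1 *m t in the usual numbering. *)
Fixpoint pull (j : nat) (t : 'cV[R]_n) : 'cV[R]_n :=
  if j is i.+1 then invmx (map_mx intr (M i)) *m pull i t else t.

Lemma pull_in_solenoid t : in_solenoid (fun j => torus_pi (pull j t)).
Proof.
apply/asboolP => j; rewrite torus_mapE /= mulKVmx //.
by rewrite unitmxE unitfE det_map_mx intr_eq0 nzmxseq_det.
Qed.

Definition solenoid_pi (t : 'cV[R]_n) : solenoid :=
  exist _ (fun j => torus_pi (pull j t) : 'cV[circle R]_n) (pull_in_solenoid t).

End Solenoid.

Arguments solenoid R {n} M.
Arguments solenoid_pi {R n} M t.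

Definition homeomorphism (X Y : topologicalType) (h : X -> Y) : Prop :=
  exists g : Y -> X, [/\ cancel h g, cancel g h, continuous h & continuous g].

Definition automorphism (G : PreTopologicalZmodule.type) (h : G -> G) : Prop :=
  zmod_morphism h /\ homeomorphism h.

Definition represents (R : realType) (n : nat) (M : nzmxseq n) (A : 'M[R]_n)
    (h : solenoid R M -> solenoid R M) : Prop :=
  automorphism h /\ h \o solenoid_pi M =1 solenoid_pi M \o mulmx A.

Definition linear_flow (R : realType) (n : nat) (M : nzmxseq n)
    (w : 'cV[R]_n) (t : R) (x : solenoid R M) : solenoid R M :=
  solenoid_pi M (t *: w) + x.

(* alpha \times h is an equivalence from the flow phi to the flow psi. *)
Definition flow_equivalence (R : realType) (X Y : topologicalType)
    (phi : R -> X -> X) (psi : R -> Y -> Y) (alpha : R -> R) (h : X -> Y) :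
    Prop :=
  [/\ zmod_morphism alpha, continuous alpha, {homo alpha : s t / s < t},
      homeomorphism h & forall t x, h (phi t x) = psi (alpha t) (h x)].

Definition flows_equivalent (R : realType) (X Y : topologicalType)
    (phi : R -> X -> X) (psi : R -> Y -> Y) : Prop :=
  exists (alpha : R -> R) (h : X -> Y), flow_equivalence phi psi alpha h.

Definition diag2 (V : pzRingType) (a d : V) : 'M[V]_2 :=
  diag_mx (\row_(i < 2) [:: a; d]`_i).

Lemma det_scal1_neq0 (P : nzseq) j : \det ((P j)%:M : 'M[int]_1) != 0.
Proof. by rewrite det_scalar expr1 nzseq_neq0. Qed.

Definition scal1_seq (P : nzseq) : nzmxseq 1 := NZMxSeq (det_scal1_neq0 P).

Lemma det_diag2_neq0 (P Q : nzseq) j : \det (diag2 (P j) (Q j)) != 0.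
Proof.
by rewrite det_diag big_ord_recl big_ord1 !mxE mulf_neq0 ?nzseq_neq0.
Qed.

Definition diag2_seq (P Q : nzseq) : nzmxseq 2 := NZMxSeq (det_diag2_neq0 P Q).

Section Multipliers.
Variable R : realType.

Local Notation sol P := (solenoid R (scal1_seq P)).

Definition sol1_pi (P : nzseq) (s : R) : sol P :=
  solenoid_pi (scal1_seq P) (const_mx s).

Definition path_comp (P : nzseq) : set (sol P) := range (sol1_pi P).

Definition one_from (P : nzseq) (N : nat) : Prop :=
  forall j, (N <= j)%N -> `|P j|%N = 1%N.

(* All of R when P is not eventually 1, and [0, p) when P is eventually 1 with
   product of terms p.  Absolute values only matter for sequences with negative
   terms; they make sol1_pi P a bijection from this domain onto path_comp P for
   every P. *)
Definition param_dom (P : nzseq) : set R :=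
  [set s | forall N, one_from P N -> 0 <= s < (\prod_(j < N) `|P j|)%N%:R].

(* Only meaningful on path_comp P, where the s with sol1_pi P s = x is unique
   in param_dom P. *)
Definition multiplier (P Q : nzseq) (r : R) (x : sol P) :
    sol Q :=
  sol1_pi Q (r * xget 0 [set s | param_dom P s /\ sol1_pi P s = x]).

Arguments path_comp : clear implicits.
Arguments multiplier : clear implicits.

Definition proper_multiplier (P Q : nzseq) (r : R) : Prop :=
  {within path_comp P, continuous (multiplier P Q r)} /\
  {in path_comp P &, {morph multiplier P Q r : x y / x + y}}.

Definition iso_multiplier (P : nzseq) (r : R) : Prop :=
  [/\ r != 0, proper_multiplier P P r & proper_multiplier P P r^-1].

End Multipliers.
Arguments sol1_pi {R} P s.
Arguments path_comp {R} P _.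
Arguments multiplier {R} P Q r x.

Section ProperArrangement.
Local Open Scope nat_scope.
Local Open Scope card_scope.

Definition prime_block (m : nat) : seq nat :=
  if m <= 1 then [:: 1] else flatten [seq nseq f.2 f.1 | f <- prime_decomp m].

(* The k-th term of the concatenation of all blocks; every block is nonempty,
   so the first k.+1 blocks contain it. *)
Definition derived (P : nzseq) (k : nat) : nat :=
  nth 1 (flatten [seq prime_block `|P i| | i <- iota 0 k.+1]) k.

(* The positions of q in P'; card_q(P') is the cardinality of this set, and
   cardinalities are compared with #<=. *)
Definition occ (q : nat) (P : nzseq) : set nat := [set k | derived P k = q].

Definition seq_le (P Q : nzseq) : Prop :=
  exists2 F : set nat, finite_set F &
    forall q, prime q -> occ q P `\` F #<= occ q Q.

(* f_0 with both arguments and the value starting from 1. *)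
Definition f0 (k i : nat) : nat := ((k + i - 2) * (k + i - 1))./2 + i.

(* l is the (prime_rank l)-th prime. *)
Definition prime_rank (l : nat) : nat := count prime (iota 0 l.+1).

Section Arrange.
Variables (n : nat) (P : 'I_n -> nzseq) (l : nat).

Definition leader (J : {set 'I_n}) : option 'I_n :=
  [pick m in J |
     [forall j in J, `[< occ l (P j) #<= occ l (P m) >]] &&
     [forall j in J, `[< occ l (P m) #<= occ l (P j) >] ==> (m <= j)]].

(* arrange N J j i is the entry of index f_0(k, i) (i >= 1) of the arranged
   sequence j, where l is the k-th prime and J is the set of indices still to
   be treated; each step treats at least one index, so N = n steps suffice. *)
Fixpoint arrange (N : nat) (J : {set 'I_n}) (j : 'I_n) (i : nat) : nat :=
  if (N, leader J) is (N'.+1, Some m) then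
    let D := [set j in J | (j == m) || `[< seq_le (P m) (P j) >]] in
    if j \in D then (if `[< `I_i #<= occ l (P m) >] then l else 1)
    else arrange N' (J :\: D)%SET j i
  else 1.

End Arrange.

Definition is_proper_arrangement (n : nat) (P Q : 'I_n -> nzseq) : Prop :=
  forall (j : 'I_n) (l i : nat), prime l -> 0 < i ->
    Q j (f0 (prime_rank l) i).-1 = (arrange P l n [set: 'I_n]%SET j i)%:Z.

Definition properly_arranged (n : nat) (P : 'I_n -> nzseq) : Prop :=
  is_proper_arrangement P P.

Definition pair_seq (P Q : nzseq) : 'I_2 -> nzseq := tnth [tuple P; Q].

End ProperArrangement.

(* Main.v *)
From HB Require Import structures.
Require Import Defs.
From mathcomp Require Import all_boot all_order all_algebra.
From mathcomp Require Import all_classical all_reals all_analysis.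
From mathcomp Require Import ring lra zify.

(** An equivalence need not be a homomorphism, but its coordinates are circle
    valued functions, and up to a bounded error such functions are characters.

    Let [f] be a continuous function from the solenoid to the circle. The
    solenoid is compact, so [f] is uniformly continuous: for some [k] it moves
    little under translation by elements whose stage [k] is small, in particular
    under [pi v] for [v] in the lattice [M_1 ... M_k Z^n]. Lift [f \o pi] to a
    real function [F] on [R^n]. For a lattice vector [v], [F (s + v) - F s]
    stays close to an integer, and this integer [m v] cannot depend on [s],
    because it changes by less than [1] along small steps. Hence [m] is
    additive, extends to a linear form [l], and [F - l] is bounded
    ([lin_lift_ex], [lin_lift_solenoid]). The form [l] depends only on [f] modulo
    constants ([lin_lift_unique]).

    Apply this to the coordinates of an equivalence [h] from the flow of [w] to
    that of [w'], whose time change is multiplication by some [c > 0]. The form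
    [l] of the first coordinate at the bottom stage is [p_1 ... p_j] times its
    form at stage [j], for every [j], and its value at [w] is [c w'_1]
    ([flow_character]). Its entries lie in [Z[1/P]] and [Z[1/Q]] and remain
    there after division by each [p_1 ... p_j]. For the entry in [Z[1/Q]] this
    forces [P <= Q] unless it vanishes, by comparing valuations
    ([transfers_seq_le]). So [l] reduces to a number [a] with [a w_1 = c w'_1]
    that maps [Z[1/P]] into itself; the second coordinate gives [d] likewise.

    The inverse equivalence provides numbers in the opposite direction. If
    [w_1] is nonzero, they show that [a] is invertible; if [w_1 = 0], then
    [w'_1 = 0] and [a = 1] serves ([iso_transfers]). Finally a matrix that is
    integral between the stages, together with its inverse, represents an
    automorphism ([solenoid_aut]), and in dimension one the endomorphism
    obtained in this way restricts to the multiplier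
    ([proper_multiplier_of_transfers]). *)

Set Implicit Arguments.
Unset Strict Implicit.
Unset Printing Implicit Defensive.

Import Order.TTheory GRing.Theory Num.Theory.
Import numFieldNormedType.Exports.
Local Open Scope classical_set_scope.
Local Open Scope ring_scope.

(** * Occurrences of primes in the derived sequence *)

Section PartialProducts.
Local Open Scope nat_scope.
Local Open Scope card_scope.
Implicit Types P Q : nzseq.

Definition pprod P j := \prod_(i < j) `|P i|.

Lemma pprodS P j : pprod P j.+1 = pprod P j * `|P j|.
Proof. by rewrite /pprod big_ord_recr. Qed.

Lemma pprod_gt0 P j : 0 < pprod P j.
Proof. by apply: prodn_gt0 => i; rewrite absz_gt0 nzseq_neq0. Qed.

Lemma dvdn_pprod P j k : j <= k -> pprod P j %| pprod P k.
Proof.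
move=> /subnK <-; elim: (k - j) => // m; rewrite addSn pprodS.
by move=> /dvdn_trans; apply; apply: dvdn_mulr.
Qed.

Definition blocks P j := flatten [seq prime_block `|P i| | i <- iota 0 j].

Lemma blocksS P j : blocks P j.+1 = blocks P j ++ prime_block `|P j|.
Proof. by rewrite /blocks -(addn1 j) iotaD map_cat flatten_cat /= cats0. Qed.

Lemma size_prime_block m : 0 < size (prime_block m).
Proof.
rewrite /prime_block; case: (leqP m 1) => // m_gt1.
have m_pdiv : pdiv m \in primes m.
  by have := m_gt1; rewrite -pi_pdiv.
have : pdiv m \in flatten [seq nseq f.2 f.1 | f <- prime_decomp m].
  apply/flattenP; exists (nseq (logn (pdiv m) m) (pdiv m)).
    apply/mapP; exists (pdiv m, logn (pdiv m) m) => //.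
    by rewrite prime_decompE; apply: map_f.
  by rewrite mem_nseq eqxx logn_gt0 m_pdiv.
by case: flatten.
Qed.

Lemma count_prime_block q m :
  prime q -> 0 < m -> count_mem q (prime_block m) = logn q m.
Proof.
move=> q_pr m_gt0; rewrite /prime_block; case: (leqP m 1) => [m_le1|m_gt1].
  have -> : m = 1 by apply/eqP; rewrite eqn_leq m_le1.
  by rewrite logn1 /=; case: q q_pr => [|[]].
rewrite prime_decompE -map_comp count_flatten -map_comp sumnE big_map /=.
under eq_bigr => p _ do rewrite /= count_nseq /=.
have [q_in|q_notin] := boolP (q \in primes m).
  rewrite (bigD1_seq q) ?primes_uniq //= eqxx mul1n big1 ?addn0 // => p.
  by move=> /negPf ->.
rewrite big_seq big1 => [|p p_in]; last first.
  by case: eqP p_in q_notin => [-> ->|].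
by apply/esym/eqP; rewrite eqn0Ngt logn_gt0.
Qed.

Lemma leq_size_blocks P j : j <= size (blocks P j).
Proof.
elim: j => // j IHj; rewrite blocksS size_cat -addn1.
exact: leq_add IHj (size_prime_block _).
Qed.

Lemma count_blocks P q j :
  prime q -> count_mem q (blocks P j) = logn q (pprod P j).
Proof.
move=> q_pr; elim: j => [|j IHj]; first by rewrite /pprod big_ord0 logn1.
have Pj_gt0 : 0 < `|P j| by rewrite absz_gt0 nzseq_neq0.
by rewrite blocksS count_cat IHj count_prime_block // pprodS lognM // pprod_gt0.
Qed.

Lemma nth_blocks P i j k : i <= j -> k < size (blocks P i) ->
  nth 1 (blocks P j) k = nth 1 (blocks P i) k.
Proof.
move=> /subnK <- k_lt; elim: (j - i) => // m IHm.
rewrite addSn blocksS nth_cat ifT //.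
apply: leq_trans k_lt _; elim: (m) => // m' IH.
by rewrite addSn blocksS size_cat; apply: leq_trans IH (leq_addr _ _).
Qed.

(** Every block is nonempty, so that a position below the length of the first
    [j] blocks is already settled by them. *)
Lemma derivedE P j k : k < size (blocks P j) ->
  derived P k = nth 1 (blocks P j) k.
Proof.
move=> k_lt; rewrite /derived -/(blocks P k.+1).
have [le_kj|/ltnW le_jk] := leqP k.+1 j; last exact: nth_blocks.
by rewrite (nth_blocks le_kj) // leq_size_blocks.
Qed.

Lemma count_derived P q j : prime q ->
  count (fun k => derived P k == q) (iota 0 (size (blocks P j)))
  = logn q (pprod P j).
Proof.
move=> q_pr; rewrite -count_blocks // -[in RHS](mkseq_nth 1 (blocks P j)).
rewrite /mkseq count_map; apply: eq_in_count => k.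
by rewrite mem_iota add0n => /= k_lt; rewrite (derivedE k_lt).
Qed.

(** The occurrences of [q] are injected into an initial segment of [nat] by
    their rank, the number of earlier occurrences. *)
Lemma occ_card_le P q e : prime q -> (forall j, logn q (pprod P j) <= e) ->
  occ q P #<= `I_e.
Proof.
move=> q_pr le_e; pose rank k := count (fun i => derived P i == q) (iota 0 k).
have rankS k : occ q P k -> rank k.+1 = (rank k).+1.
  by rewrite /occ /= /rank -(addn1 k) iotaD count_cat /= => ->; rewrite eqxx addn1.
have rank_mono i k : i <= k -> rank i <= rank k.
  by move=> /subnKC <-; rewrite /rank iotaD count_cat leq_addr.
have rank_lt i k : i < k -> occ q P i -> rank i < rank k.
  by move=> lt_ik /rankS <-; apply: rank_mono.
have rank_inj : {in occ q P &, injective rank}.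
  move=> i k /set_mem occ_i /set_mem occ_k eq_rank.
  by case: (ltngtP i k) => // /rank_lt lt_rank;
    [move: (lt_rank occ_i)|move: (lt_rank occ_k)]; rewrite eq_rank ltnn.
rewrite -(card_le_eql (inj_card_eq rank_inj)).
apply: subset_card_le => _ [k occ_k <-] /=.
rewrite -(rankS k occ_k) (leq_trans _ (le_e k.+1)) // -count_derived //.
exact: rank_mono (leq_size_blocks _ _).
Qed.

Lemma occ_card_ge P q j : prime q -> `I_(logn q (pprod P j)) #<= occ q P.
Proof.
move=> q_pr.
pose s := [seq k <- iota 0 (size (blocks P j)) | derived P k == q].
have size_s : size s = logn q (pprod P j) by rewrite size_filter count_derived.
have s_uniq : uniq s by rewrite filter_uniq // iota_uniq.
have nth_inj : {in `I_(size s) &, injective (nth 0 s)}.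
  by move=> i k /set_mem/= i_lt /set_mem/= k_lt /eqP; rewrite nth_uniq // => /eqP.
rewrite -size_s -(card_le_eql (inj_card_eq nth_inj)).
apply: subset_card_le => _ [i /= i_lt <-].
by have := mem_nth 0 i_lt; rewrite mem_filter => /andP[/eqP].
Qed.

(** Valuations turn the divisibility into [v_q(p_1...p_j) <= v_q(z) + card_q(Q')]
    for every prime [q]; only the finitely many prime divisors of [z] can
    violate the comparison, and each of them occurs finitely often in [P'] when
    it does in [Q'], so that these occurrences may be deleted. *)
Lemma seq_le_of_dvdn P Q z : 0 < z ->
  (forall j, exists k, pprod P j %| z * pprod Q k) -> seq_le P Q.
Proof.
move=> z_gt0 dvd_z.
exists (\bigcup_(q in [set q | q \in primes z /\ finite_set (occ q P)]) occ q P).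
  apply: bigcup_finite => [|q []//].
  by apply: (@sub_finite_set _ _ [set` primes z]) => [q []|].
move=> q q_pr; have [Q_fin|Q_inf] := pselect (finite_set (occ q Q)); last first.
  apply: card_le_trans (_ : [set: nat] #<= _); last exact/infiniteP.
  exact: subset_card_le.
have /finite_setP[e Qe] := Q_fin.
have P_le : occ q P #<= `I_(logn q z + e).
  apply: occ_card_le => // j; have [k /dvdn_leq_log] := dvd_z j.
  move=> /(_ q); rewrite muln_gt0 z_gt0 pprod_gt0 => /(_ isT) /leq_trans; apply.
  rewrite lognM ?pprod_gt0 // leq_add2l.
  by have := occ_card_ge Q k q_pr; rewrite (card_le_eqr Qe) card_le_II.
have P_fin : finite_set (occ q P).
  by apply: card_le_finite P_le _; apply: finite_II.
have [q_z|q_notin_z] := boolP (q \in primes z).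
  rewrite (_ : _ `\` _ = set0); first exact: card_ge0.
  by apply/seteqP; split=> // k [/= occ_k]; apply; exists q.
apply: card_le_trans (subset_card_le (@subDsetl _ _ _)) _.
rewrite (card_le_eqr Qe); move: P_le; rewrite (_ : logn q z = 0) //.
by apply/eqP; rewrite eqn0Ngt logn_gt0.
Qed.

(** The partial products of [P] all divide the product of its first [N]
    terms. *)
Lemma one_from_seq_le P Q N : one_from P N -> seq_le P Q.
Proof.
move=> P1; apply: (@seq_le_of_dvdn P Q (pprod P N)) => [|j]; first exact: pprod_gt0.
exists 0; rewrite dvdn_mulr //.
have [|le_Nj] := leqP j N; first exact: dvdn_pprod.
have /subnK <- := ltnW le_Nj; elim: (j - N) => // m; rewrite addSn pprodS.
by rewrite (P1 (m + N)) ?muln1 // leq_addl.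
Qed.

End PartialProducts.

(** * Small elements of the circle *)

Section SmallElements.
Variable R : realType.
Implicit Types (x y e : R) (c d : circle R).

Lemma circle_pi_eq0 x : circle_pi x = 0 <-> x \is a Num.int.
Proof.
rewrite -(raddf0 (@circle_pi R)) /circle_pi.
have /= := Quotient.idealrBE (int_zmod R) x 0; rewrite subr0 => E.
by split=> [pi_x|x_int]; [rewrite E; apply/eqP|move: x_int; rewrite E => /eqP].
Qed.

Lemma circle_pi_eq x y : circle_pi x = circle_pi y <-> x - y \is a Num.int.
Proof.
rewrite -circle_pi_eq0; have -> : circle_pi (x - y) = circle_pi x - circle_pi y.
  exact: raddfB.
by split=> [->|]; [exact: subrr|exact: subr0_eq].
Qed.

Lemma circle_pi_inj x y : circle_pi x = circle_pi y -> `|x - y| < 1 -> x = y.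
Proof.
move=> /circle_pi_eq /intrP[m xy_m]; rewrite xy_m -intr_norm ltrz1 => m_lt1.
have m0 : m = 0 by lia.
by apply/eqP; rewrite -subr_eq0 xy_m m0.
Qed.

Lemma circle_piD x y : circle_pi (x + y) = circle_pi x + circle_pi y.
Proof. exact: raddfD. Qed.

Lemma circle_piB x y : circle_pi (x - y) = circle_pi x - circle_pi y.
Proof. exact: raddfB. Qed.

Lemma circle_piMz x (m : int) : circle_pi (x *~ m) = circle_pi x *~ m.
Proof. exact: raddfMz. Qed.

Lemma circle_pi_surj c : exists x, circle_pi x = c.
Proof. by exists (repr c); exact: reprK. Qed.

(** Smallness in the circle is measured by real representatives, which makes it
    compatible with lifting. *)
Definition small e c := exists2 u, `|u| < e & circle_pi u = c.

Lemma small0 e : 0 < e -> small e 0.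
Proof. by exists 0; rewrite ?normr0 // raddf0. Qed.

Lemma small_le e e' c : e <= e' -> small e c -> small e' c.
Proof. by move=> le_ee' [u u_lt <-]; exists u => //; apply: lt_le_trans le_ee'. Qed.

Lemma smallD e e' c d : small e c -> small e' d -> small (e + e') (c + d).
Proof.
move=> [u u_lt <-] [v v_lt <-]; exists (u + v); last exact: circle_piD.
by rewrite (le_lt_trans (ler_normD _ _)) ?ltrD.
Qed.

Lemma smallN e c : small e c -> small e (- c).
Proof. by move=> [u u_lt <-]; exists (- u); rewrite ?normrN // raddfN. Qed.

(** A small element of the circle has only one representative near [0]. *)
Lemma small_pi e x : small e (circle_pi x) -> `|x| + e <= 1 -> `|x| < e.
Proof.
move=> [u u_lt ux] xe1; suff -> : x = u by [].
apply: circle_pi_inj => //; apply: le_lt_trans (ler_normB _ _) _.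
by apply: lt_le_trans xe1; rewrite ltrD2l.
Qed.

(** The circle is Hausdorff. *)
Lemma small_eq0 c : (forall e, 0 < e -> small e c) -> c = 0.
Proof.
move=> c_small; have [|u u_lt uc] := c_small (1 / 2%:R); first lra.
rewrite -uc; have [->|u_neq0] := eqVneq u 0; first exact: raddf0.
have u_gt0 : 0 < `|u| by rewrite normr_gt0.
have : `|u| < `|u| by apply: small_pi; [rewrite uc; exact: c_small|lra].
by rewrite ltxx.
Qed.

End SmallElements.

(** * Lifting circle-valued functions on real vector spaces *)

Section GroupIdentities.
Variable V : zmodType.
Implicit Types a b c : V.

Lemma subr_telescope a b c : (b - a) + (c - b) = c - a.
Proof. by rewrite addrC subrKA. Qed.

Lemma subr_cancel a b c : (a - c) - (b - c) = a - b.
Proof. by rewrite opprB addrA subrK. Qed.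

End GroupIdentities.

Definition cube (R : realType) n (e : R) (u : 'cV[R]_n) :=
  forall i, `|u i 0| <= e.

Lemma cube_mulmx (R : realType) n p (A : 'M[R]_(p, n)) (e : R) : 0 < e ->
  exists2 d, 0 < d & forall u, cube d u -> cube e (A *m u).
Proof.
move=> e_gt0; pose K := \sum_i \sum_j `|A i j|.
have K_ge0 : 0 <= K by apply: sumr_ge0 => i _; apply: sumr_ge0.
have K1_gt0 : 0 < K + 1 by rewrite ltr_wpDl.
exists (e / (K + 1)) => [|u u_le i]; first exact: divr_gt0.
have row_le : \sum_j `|A i j| <= K + 1.
  by rewrite ler_wpDr // /K (bigD1 i) //= lerDl; apply: sumr_ge0 => *; apply: sumr_ge0.
have d_ge0 : 0 <= e / (K + 1) by rewrite divr_ge0 // ltW.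
apply: (@le_trans _ _ ((\sum_j `|A i j|) * (e / (K + 1)))).
  rewrite mxE mulr_suml; apply: le_trans (ler_norm_sum _ _ _) _.
  by apply: ler_sum => j _; rewrite normrM ler_wpM2l.
by apply: le_trans (ler_wpM2r d_ge0 row_le) _; rewrite mulrC divfK ?gt_eqF.
Qed.

Section Lifting.
Variables (R : realType) (n : nat).
Implicit Types (s t u v : 'cV[R]_n) (e : R).

Lemma cubeZ e a u : cube e u -> cube (`|a| * e) (a *: u).
Proof. by move=> u_le i; rewrite !mxE normrM ler_wpM2l. Qed.

Lemma cube_le e e' u : e <= e' -> cube e u -> cube e' u.
Proof. by move=> le_ee' u_le i; apply: le_trans le_ee'. Qed.

Lemma cube0 e : 0 <= e -> cube e (0 : 'cV[R]_n).
Proof. by move=> e_ge0 i; rewrite mxE normr0. Qed.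

Lemma cube_eq0 u : cube 0 u -> u = 0.
Proof.
move=> u_le; apply/matrixP => i j; rewrite ord1 mxE; apply/eqP.
by rewrite -normr_le0 u_le.
Qed.

Lemma cube_archi e u : 0 < e -> exists N, cube (e * N%:R) u.
Proof.
move=> e_gt0; exists (\sum_i Num.bound (`|u i 0%R| / e)%R)%N => i.
rewrite mulrC -ler_pdivrMr //; apply: le_trans (ltW (archi_boundP _)) _.
  by rewrite divr_ge0 // ltW.
by rewrite ler_nat (bigD1 i) //= leq_addr.
Qed.

(** Walk from [0] to [s] in [N] equal steps; the cube is convex, so the walk
    stays in it. *)
Lemma cube_walk (E : 'cV[R]_n -> R) e c N :
  (forall s u, cube (e * N%:R) s -> cube (e * N%:R) (s + u) ->
     cube e u -> `|E (s + u) - E s| <= c) ->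
  forall s, cube (e * N%:R) s -> `|E s - E 0| <= c * N%:R.
Proof.
move=> step s s_le; have [N0|N_gt0] := posnP N.
  move: s_le; rewrite N0 mulr0 => /cube_eq0 ->.
  by rewrite subrr normr0 mulr0.
have NR_gt0 : 0 < N%:R :> R by rewrite ltr0n.
suff walk k : (k <= N)%N -> `|E ((k%:R / N%:R) *: s) - E 0| <= c * k%:R.
  by have := walk N (leqnn N); rewrite divff ?lt0r_neq0 // scale1r.
have in_cube k' : (k' <= N)%N -> cube (e * N%:R) ((k'%:R / N%:R) *: s).
  move=> le_kN i; rewrite !mxE normrM; apply: le_trans (s_le i).
  rewrite ler_piMl // ger0_norm ?divr_ge0 //.
  by rewrite ler_pdivrMr // mul1r ler_nat.
elim: k => [_|k IHk lt_kN]; first by rewrite mul0r scale0r subrr normr0 mulr0.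
rewrite -(subrKA (E ((k%:R / N%:R) *: s))).
apply: le_trans (ler_normD _ _) _.
rewrite -[X in _ <= _ * X]natr1 mulrDr mulr1 addrC.
apply: lerD; first exact: IHk (ltnW lt_kN).
have stepE : (k.+1%:R / N%:R) *: s =
    (k%:R / N%:R) *: s + N%:R^-1 *: s.
  by rewrite -scalerDl -natr1 mulrDl mul1r.
rewrite stepE; apply: step.
- exact: in_cube (ltnW lt_kN).
- by rewrite -stepE; exact: in_cube.
- move=> i; rewrite mxE normrM ger0_norm ?invr_ge0 // mulrC ler_pdivrMr //.
Qed.

(** Connectedness in a discrete form: the jumps of [E] are integers, hence [0]
    when they are smaller than [1]. *)
Lemma cube_const (E : 'cV[R]_n -> R) e N :
  (forall s u, cube (e * N%:R) s -> cube (e * N%:R) (s + u) ->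
     cube e u -> `|E (s + u) - E s| < 1) ->
  (forall s, cube (e * N%:R) s -> circle_pi (E s) = circle_pi (E 0)) ->
  forall s, cube (e * N%:R) s -> E s = E 0.
Proof.
move=> step E_int s s_le; apply/eqP; rewrite -subr_eq0 -normr_le0.
rewrite -(mul0r N%:R); apply: cube_walk s_le => t u t_le tu_le u_le.
rewrite normr_le0 subr_eq0; apply/eqP; apply: circle_pi_inj; last exact: step.
by rewrite !E_int.
Qed.

Lemma space_const (E : 'cV[R]_n -> R) e : 0 < e ->
  (forall s u, cube e u -> `|E (s + u) - E s| < 1) ->
  (forall s, circle_pi (E s) = circle_pi (E 0)) -> forall s, E s = E 0.
Proof.
move=> e_gt0 step E_int s; have [N s_le] := cube_archi s e_gt0.
by apply: (cube_const (e := e) (N := N)) => // *; apply: step.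
Qed.

Section Lift.
Variables (g : 'cV[R]_n -> circle R) (e : R).
Hypothesis e_gt0 : 0 < e.
Hypothesis g_step : forall s u, cube e u -> small 8%:R^-1 (g (s + u) - g s).

(** A lift of [g - g 0] on the cube of half-side [e * N]. The bound [1/8] lets
    four increments over steps in the cube of half-side [e] add up to less than
    [1], so that their sum is [0] as soon as its class modulo [1] is. *)
Definition lift_on N (F : 'cV[R]_n -> R) := [/\ F 0 = 0,
  forall s, cube (e * N%:R) s -> circle_pi (F s) = g s - g 0 &
  forall s u, cube (e * N%:R) s -> cube (e * N%:R) (s + u) ->
    cube e u -> `|F (s + u) - F s| < 8%:R^-1].

(** Contract the larger cube onto the smaller one and add the small
    representative [D s] of what [g] gains on the way back. *)
Lemma lift_onS N F : lift_on N F -> exists F', lift_on N.+1 F'.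
Proof.
move=> [F0 F_lift F_step].
have /choice[D DP] s : exists d : R, cube (e * N.+1%:R) s ->
    `|d| < 8%:R^-1 /\ circle_pi d = g s - g ((N%:R / N.+1%:R) *: s).
  have [s_le|] := pselect (cube (e * N.+1%:R) s); last by exists 0.
  have [|d d_lt dP] := @g_step ((N%:R / N.+1%:R) *: s) (N.+1%:R^-1 *: s).
    move=> i; rewrite mxE normrM ger0_norm ?invr_ge0 // mulrC ler_pdivrMr ?ltr0n //.
  exists d => _; split=> //; rewrite dP -scalerDl -[X in _ / _ + X]mul1r.
  by rewrite -mulrDl natr1 divff ?scale1r // pnatr_eq0.
exists (fun s => F ((N%:R / N.+1%:R) *: s) + D s).
set c := N%:R / N.+1%:R in D DP *.
have c_cube s : cube (e * N.+1%:R) s -> cube (e * N%:R) (c *: s).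
  move=> s_le i; rewrite mxE normrM ger0_norm ?divr_ge0 //.
  rewrite /c mulrAC ler_pdivrMr ?ltr0n // mulrAC mulrC.
  by rewrite ler_wpM2r.
have lift s : cube (e * N.+1%:R) s ->
    circle_pi (F (c *: s) + D s) = g s - g 0.
  move=> s_le; have [_ Ds] := DP s s_le.
  rewrite circle_piD F_lift ?Ds; first exact: subr_telescope.
  exact: c_cube.
have zero_in : cube (e * N.+1%:R) (0 : 'cV[R]_n).
  by apply: cube0; rewrite mulr_ge0 // ltW.
split=> // [|s u s_le su_le u_le].
  have [D0_lt _] := DP 0 zero_in; rewrite scaler0 F0 add0r.
  apply: circle_pi_inj; last by rewrite subr0; lra.
  by have := lift 0 zero_in; rewrite scaler0 F0 add0r subrr => ->; rewrite raddf0.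
have [d d_lt dP] := g_step s u_le; have [Ds_lt _] := DP s s_le.
have [Dsu_lt _] := DP (s + u) su_le.
have cu_le : cube e (c *: u).
  apply: cube_le (cubeZ c u_le); rewrite ler_piMl ?(ltW e_gt0) // ger0_norm.
    by rewrite /c ler_pdivrMr ?ltr0n // mul1r ler_nat.
  by rewrite divr_ge0.
have := F_step _ _ (c_cube s s_le) _ cu_le.
rewrite -scalerDr => /(_ (c_cube _ su_le)) F_lt.
suff <- : d = F (c *: (s + u)) + D (s + u) - (F (c *: s) + D s) by [].
apply: circle_pi_inj.
  by rewrite dP circle_piB !lift // subr_cancel.
by move: F_lt Ds_lt Dsu_lt d_lt; rewrite !ltr_norml; lra.
Qed.

Lemma lift_on_ex N : exists F, lift_on N F.
Proof.
elim: N => [|N [F /lift_onS]//]; exists (fun=> 0); split=> // [s|s u _ _ _].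
  by rewrite mulr0 => /cube_eq0 ->; rewrite subrr raddf0.
by rewrite subrr normr0; lra.
Qed.

Lemma lift_on_unique N N' F F' s : (N <= N')%N -> lift_on N F -> lift_on N' F' ->
  cube (e * N%:R) s -> F s = F' s.
Proof.
move=> le_NN' [F0 F_lift F_step] [F'0 F'_lift F'_step] s_le.
have widen t : cube (e * N%:R) t -> cube (e * N'%:R) t.
  by apply: cube_le; rewrite ler_wpM2l ?ler_nat // ltW.
apply/eqP; rewrite -subr_eq0; apply/eqP.
rewrite (@cube_const (fun t => F t - F' t) e N) ?F0 ?F'0 ?subrr // => [t u|t] t_le.
  move=> tu_le u_le.
  have := F'_step _ _ (widen _ t_le) (widen _ tu_le) u_le.
  by move: (F_step _ _ t_le tu_le u_le); rewrite !ltr_norml; lra.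
by rewrite circle_piB F_lift // F'_lift ?subrr ?raddf0 //; exact: widen.
Qed.

(** The lifts on the cubes extend each other by uniqueness, so they glue. *)
Lemma lift_ex : exists F : 'cV[R]_n -> R, (forall s, circle_pi (F s) = g s) /\
  forall s u, cube e u -> `|F (s + u) - F s| < 8%:R^-1.
Proof.
have /choice[F FP] := lift_on_ex.
have /choice[N NP] s := cube_archi s e_gt0.
have FE s M : (N s <= M)%N -> F (N s) s = F M s.
  by move=> le_M; apply: (@lift_on_unique (N s) M).
have [c cP] := circle_pi_surj (g 0).
exists (fun s => c + F (N s) s); split=> [s|s u u_le].
  by have [_ F_lift _] := FP (N s); rewrite circle_piD cP F_lift // addrC subrK.
rewrite opprD addrACA subrr add0r.
rewrite (FE s (maxn (N s) (N (s + u)))) ?leq_maxl //.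
rewrite (FE (s + u) (maxn (N s) (N (s + u)))) ?leq_maxr //.
have [_ _] := FP (maxn (N s) (N (s + u))); apply=> //;
  by apply: cube_le (NP _); rewrite ler_wpM2l ?(ltW e_gt0) // ler_nat;
  rewrite ?leq_maxl ?leq_maxr.
Qed.

End Lift.

Definition unif_cont (F : 'cV[R]_n -> R) := forall eta, 0 < eta ->
  exists2 e, 0 < e & forall s u, cube e u -> `|F (s + u) - F s| < eta.

(** [g] has a lift at bounded distance from the linear form [l]: the homotopy
    class of [g] is that of the homomorphism induced by [l]. *)
Definition lin_lift (g : 'cV[R]_n -> circle R) (l : 'rV[R]_n) :=
  exists F : 'cV[R]_n -> R, [/\ forall s, circle_pi (F s) = g s, unif_cont F &
    exists C, forall s, `|F s - (l *m s) 0 0| <= C].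

(** When [v] is integral, [F (s + v) - F s] is within [1/8] of an integer [m v]
    independent of [s]. As [s] is an integral vector plus one of the unit cube,
    the form with coefficients [m e_i] stays at bounded distance from [F]. *)
Lemma lin_lift_ex (g : 'cV[R]_n -> circle R) :
  (forall eta, 0 < eta ->
     exists2 e, 0 < e & forall s u, cube e u -> small eta (g (s + u) - g s)) ->
  (forall s (v : 'cV[int]_n), small 8%:R^-1 (g (s + map_mx intr v) - g s)) ->
  exists z : 'rV[int]_n, lin_lift g (map_mx intr z).
Proof.
move=> g_ucont g_lattice.
have [|e e_gt0 g_step] := g_ucont 8%:R^-1; first by rewrite invr_gt0.
have [F [F_lift F_step]] := lift_ex e_gt0 g_step.
have F_ucont : unif_cont F.
  move=> eta eta_gt0.
  (* The cap 1/8 provides the second hypothesis of [small_pi]. *)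
  have [|d d_gt0 g_eta] := g_ucont (Num.min eta 8%:R^-1).
    by rewrite lt_min eta_gt0 invr_gt0 /=.
  exists (Num.min e d) => [|s u u_le]; first by rewrite lt_min e_gt0.
  have F_lt : `|F (s + u) - F s| < 8%:R^-1.
    by apply: F_step; apply: cube_le u_le; rewrite ge_min lexx.
  have /(g_eta s) : cube d u.
    by apply: cube_le u_le; rewrite ge_min lexx orbT.
  rewrite -!F_lift -circle_piB => /small_pi.
  have le_8 : Num.min eta 8%:R^-1 <= 8%:R^-1 by rewrite ge_min lexx orbT.
  move=> F_min; apply: lt_le_trans (F_min _) _; last by rewrite ge_min lexx.
  by move: F_lt le_8; lra.
have /choice[m mP] (v : 'cV[int]_n) : exists z : int,
    forall s, `|F (s + map_mx intr v) - F s - z%:~R| < 8%:R^-1.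
  have /choice[D DP] s : exists d : R, `|d| < 8%:R^-1 /\
      circle_pi d = g (s + map_mx intr v) - g s.
    by have [d] := g_lattice s v; exists d.
  pose E s := F (s + map_mx intr v) - F s - D s.
  have E_int s : circle_pi (E s) = 0.
    by have [_ Ds] := DP s; rewrite !circle_piB !F_lift Ds subrr.
  have E_const : forall s, E s = E 0.
    apply: (space_const e_gt0) => [s u u_le|s]; last by rewrite !E_int.
    have := F_step s u u_le; have := F_step (s + map_mx intr v) u u_le.
    have [] := DP s; have [] := DP (s + u); rewrite /E addrAC.
    by move=> + _ + _; rewrite !ltr_norml; lra.
  have /circle_pi_eq0/intrP[z zP] := E_int 0; exists z => s.
  have [Ds_lt _] := DP s; rewrite -zP -(E_const s) /E opprB addrC subrK //.
(* Two integers at distance less than 1 of each other are equal. *)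
have m_eq (v : 'cV[int]_n) z s :
    `|F (s + map_mx intr v) - F s - z%:~R| < 1 - 8%:R^-1 -> m v = z.
  move=> z_lt; apply/eqP; rewrite -subr_eq0 -normr_le0 -ltzD1 add0r -(ltr_int R).
  have := mP v s; rewrite intr_norm intrB; move: z_lt.
  by rewrite !ltr_norml; lra.
have mD (u v : 'cV[int]_n) : m (u + v) = m u + m v.
  apply: (@m_eq _ _ 0); have := mP u 0; have := mP v (map_mx intr u).
  rewrite map_mxD intrD !add0r !ltr_norml.
  by lra.
have mB : zmod_morphism m.
  by move=> u v; apply/eqP; rewrite eq_sym subr_eq -mD subrK.
pose mA : {additive 'cV[int]_n -> int} :=
  HB.pack m (GRing.isZmodMorphism.Build _ _ m mB).
pose z : 'rV[int]_n := \row_i m (delta_mx i 0).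
have mE (v : 'cV[int]_n) : (map_mx intr z *m map_mx intr v) 0 0 = (m v)%:~R :> R.
  rewrite -map_mxM mxE; congr (_%:~R).
  rewrite -[m v]/(mA v) [in RHS](matrix_sum_delta v) raddf_sum mxE.
  apply: eq_bigr => i _; rewrite big_ord1 -[v i 0]intz scaler_int raddfMz.
  by rewrite mxE !mulrzz mul1r.
exists z, F; split=> //.
have [N cube_le] := cube_archi (const_mx 1 : 'cV[R]_n) e_gt0.
exists (8%:R^-1 + (`|F 0| + 8%:R^-1 * N%:R) + \sum_i `|z 0 i|%:~R) => s.
pose v : 'cV[int]_n := map_mx Num.floor s; pose r := s - map_mx intr v.
have r_le : cube 1 r.
  move=> i; rewrite !mxE; have /andP[] := floor_itv (s i 0).
  by rewrite intrD ler_norml; lra.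
have F_r : `|F r - F 0| <= 8%:R^-1 * N%:R.
  apply: (cube_walk (e := e)) => [t u _ _ u_le|]; first exact: ltW (F_step _ _ u_le).
  move=> i; apply: le_trans (r_le i) _.
  by have := cube_le i; rewrite mxE normr1.
have z_r : `|(map_mx intr z *m r) 0 0| <= \sum_i `|z 0 i|%:~R.
  rewrite mxE; apply: le_trans (ler_norm_sum _ _ _) _; apply: ler_sum => i _.
  by rewrite normrM mxE intr_norm ler_piMr //; exact: r_le.
have := mP v r; rewrite subrK => F_v.
have zs : (map_mx intr z *m s) 0 0 = (map_mx intr z *m r) 0 0 + (m v)%:~R.
  by rewrite -mE -[s in LHS](subrK (map_mx intr v)) mulmxDr [LHS]mxE.
rewrite zs; have := ler_norm (F 0); have := ler_norm (- F 0).
by move: F_r z_r F_v; rewrite normrN !ler_norml !ltr_norml; lra.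
Qed.

Lemma lin_lift_affine (l : 'rV[R]_n) (c : circle R) :
  lin_lift (fun s => circle_pi ((l *m s) 0 0) + c) l.
Proof.
have [x <-] := circle_pi_surj c.
exists (fun s => (l *m s) 0 0 + x); split=> [s|eta eta_gt0|].
- exact: circle_piD.
- have [|d d_gt0 l_d] := @cube_mulmx R n 1 l (eta / 2%:R).
    by rewrite divr_gt0.
  exists d => // s u /l_d/(_ 0); rewrite mulmxDr [X in X + x]mxE.
  rewrite (_ : _ - _ = (l *m u) 0 0); last by ring.
  by move/le_lt_trans; apply; lra.
- by exists `|x| => s; rewrite addrC addKr.
Qed.

Lemma lin_lift_mulz g l (m : int) :
  lin_lift g l -> lin_lift (fun s => g s *~ m) (m%:~R *: l).
Proof.
move=> [F [F_lift F_ucont [C F_le]]]; exists (fun s => m%:~R * F s); split.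
- by move=> s; rewrite mulrzl circle_piMz F_lift.
- move=> eta eta_gt0; have M_gt0 : 0 < `|m|%:~R + 1 :> R.
    by rewrite ltr_wpDl ?ler0z.
  have [|e e_gt0 F_e] := F_ucont (eta / (`|m|%:~R + 1)); first exact: divr_gt0.
  exists e => // s u /(F_e s); rewrite ltr_pdivlMr // -mulrBr normrM -intr_norm.
  by apply: le_lt_trans; rewrite mulrC ler_wpM2l // lerDl.
- exists (`|m|%:~R * C) => s; rewrite -scalemxAl [X in _ - X]mxE -mulrBr normrM.
  by rewrite intr_norm ler_wpM2l.
Qed.

(** The difference of the two lifts is constant, and only the zero linear form
    is bounded. *)
Lemma lin_lift_unique g g' l l' c :
  lin_lift g l -> lin_lift g' l' -> (forall s, g s - g' s = c) -> l = l'.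
Proof.
move=> [F [F_lift F_ucont [C F_le]]] [F' [F'_lift F'_ucont [C' F'_le]]] gg'.
have half_gt0 : 0 < 2%:R^-1 :> R by rewrite invr_gt0.
have [e e_gt0 F_e] := F_ucont _ half_gt0.
have [e' e'_gt0 F'_e] := F'_ucont _ half_gt0.
have FF' s : F s - F' s = F 0 - F' 0.
  apply: (@space_const (fun t => F t - F' t) (Num.min e e')) => [|t u u_le|t].
  - by rewrite lt_min e_gt0.
  - have /(F_e t) : cube e u by apply: cube_le u_le; rewrite ge_min lexx.
    have /(F'_e t) : cube e' u.
      by apply: cube_le u_le; rewrite ge_min lexx orbT.
    by rewrite !ltr_norml; lra.
  - by rewrite !circle_piB !F_lift !F'_lift !gg'.
pose B := C + C' + `|F 0 - F' 0|.
have ll'_le s : `|((l - l') *m s) 0 0| <= B.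
  have -> : ((l - l') *m s) 0 0 = (l *m s) 0 0 - (l' *m s) 0 0.
    by rewrite mulmxBl !mxE.
  have := ler_norm (F 0 - F' 0); have := ler_norm (- (F 0 - F' 0)).
  rewrite normrN /B -(FF' s); move: (F_le s) (F'_le s).
  by rewrite !ler_norml; lra.
apply/eqP; rewrite -subr_eq0; apply/eqP/matrixP => i j; rewrite ord1 [RHS]mxE.
apply/eqP; apply: contraT => x_neq0; set x := (l - l') 0 j in x_neq0.
(* At this multiple of a basis vector the form takes the value [B + 1]. *)
have := ll'_le (((B + 1) / x) *: delta_mx j 0).
rewrite -scalemxAr -colE [X in `|X|]mxE [X in _ * X]mxE -/x divfK //.
by have := ler_norm (B + 1); lra.
Qed.

End Lifting.

Lemma lin_lift_comp (R : realType) n m (g : 'cV[R]_n -> circle R) l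
    (A : 'M[R]_(n, m)) :
  lin_lift g l -> lin_lift (g \o mulmx A) (l *m A).
Proof.
move=> [F [F_lift F_ucont [C F_le]]]; exists (F \o mulmx A); split.
- by move=> s /=; rewrite F_lift.
- move=> eta /F_ucont[e e_gt0 F_e]; have [d d_gt0 A_d] := cube_mulmx A e_gt0.
  by exists d => // s u /A_d/(F_e (A *m s)); rewrite /= mulmxDr.
- by exists C => s /=; rewrite -mulmxA.
Qed.

(** * Topology of the torus and of the solenoid *)

Section TorusTopology.
Variable R : realType.

Lemma nbhs_circleP (c : circle R) (U : set (circle R)) :
  nbhs c U <-> exists2 e, 0 < e & forall d, small e (d - c) -> U d.
Proof.
have [x <-] := circle_pi_surj c; split.
  rewrite nbhsE => -[B [Bo Bx] BU].
  have : nbhs x (@circle_pi R @^-1` B).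
    exact: (open_nbhs_nbhs (conj (Bo : open (@circle_pi R @^-1` B)) Bx)).
  move=> /nbhs_ballP[e /= e_gt0 xeB]; exists e => // d [u u_lt ud].
  apply: BU; have -> : d = circle_pi (x + u) by rewrite circle_piD ud addrC subrK.
  by apply: xeB; rewrite /ball /= opprD addrA subrr add0r normrN.
move=> [e e_gt0 sub_U]; pose V := [set d | small e (d - circle_pi x)].
suff Vo : open V.
  apply: filterS (open_nbhs_nbhs (conj Vo _)) => [d|]; first exact: sub_U.
  by rewrite /V /= subrr; exact: small0.
suff : open (@circle_pi R @^-1` V) by [].
rewrite openE => y [u u_lt uy]; apply/nbhs_ballP; exists (e - `|u|) => /=.
  by rewrite subr_gt0.
move=> z; rewrite /ball /= => yz; exists (u + (z - y)).
  rewrite (le_lt_trans (ler_normD _ _)) // addrC -ltrBrDr.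
  by rewrite distrC.
by rewrite circle_piD uy circle_piB subr_telescope.
Qed.

Variable n : nat.

Definition tsmall e (x : 'cV[circle R]_n) := forall i, small e (x i 0).

Lemma tsmall_le e e' x : e <= e' -> tsmall e x -> tsmall e' x.
Proof. by move=> le_ee' x_e i; apply: small_le (x_e i). Qed.

Lemma tsmallD e e' x y : tsmall e x -> tsmall e' y -> tsmall (e + e') (x + y).
Proof. by move=> x_e y_e i; rewrite mxE; apply: smallD. Qed.

(** The factor [2] turns the closed cube into a strict inequality. *)
Lemma tsmall_pi e u : 0 < e -> cube e u -> tsmall (2%:R * e) (torus_pi u).
Proof.
move=> e_gt0 u_le i; exists (u i 0); last by rewrite mxE.
by apply: le_lt_trans (u_le i) _; lra.
Qed.

Lemma tsmall_lift e x : tsmall e x -> exists2 u, cube e u & torus_pi u = x.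
Proof.
move=> x_e; have /choice[u uP] i : exists u, `|u| <= e /\ circle_pi u = x i 0.
  by have [u /ltW u_le ux] := x_e i; exists u.
exists (\col_i u i) => [i|]; first by rewrite mxE; have [] := uP i.
by apply/matrixP => i j; rewrite ord1 !mxE; have [] := uP i.
Qed.

Lemma torus_pi_surj (x : 'cV[circle R]_n) : exists u, torus_pi u = x.
Proof.
have /choice[u uP] i := circle_pi_surj (x i 0).
by exists (\col_i u i); apply/matrixP => i j; rewrite ord1 !mxE uP.
Qed.

Lemma torus_map_tsmall (M : 'M[int]_n) e : 0 < e ->
  exists2 d, 0 < d & forall x, tsmall d x -> tsmall e (torus_map M x).
Proof.
move=> e_gt0; have e2_gt0 : 0 < e / 2%:R by rewrite divr_gt0.
have [d d_gt0 Md] := cube_mulmx (map_mx intr M) e2_gt0.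
exists d => // x /tsmall_lift[u /Md/(tsmall_pi e2_gt0) + <-].
by rewrite torus_mapE mulrC divfK // pnatr_eq0.
Qed.

Lemma nbhs_torusP (x : 'cV[circle R]_n) (U : set 'cV[circle R]_n) :
  nbhs x U <-> exists2 e, 0 < e & forall y, tsmall e (y - x) -> U y.
Proof.
split=> [[P P_nbhs sub_U]|[e e_gt0 sub_U]].
  have /choice[e eP] i : exists e, 0 < e /\ forall d, small e (d - x i 0) -> P i 0 d.
    by have /nbhs_circleP[e e_gt0 eP] := P_nbhs i 0; exists e.
  exists (\big[Order.min/1]_i e i) => [|y y_e].
    by apply: lt_bigmin => // i _; have [] := eP i.
  apply: sub_U => i j; rewrite ord1; have [_] := eP i; apply.
  have le_e : \big[Order.min/1]_k e k <= e i by exact: bigmin_le.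
  by have := y_e i; rewrite !mxE; exact: small_le.
exists (fun i _ => [set d | small e (d - x i 0)]) => [i j|y y_e].
  by rewrite ord1; apply/nbhs_circleP; exists e.
by apply: sub_U => i; rewrite !mxE; exact: y_e.
Qed.

(** The torus is the image of the unit cube. *)
Lemma torus_compact : compact [set: 'cV[circle R]_n].
Proof.
pose f (v : 'rV[R]_n) : 'cV[circle R]_n := torus_pi v^T.
pose box := [set v : 'rV[R]_n | forall i, `[0, 1]%classic (v ord0 i)].
have box_compact : compact box 
  by apply: (@rV_compact R n (fun=> `[0, 1]%classic)) => i; exact: segment_compact.
have f_cont : continuous f.
  move=> v U /nbhs_torusP[e e_gt0 sub_U].
  exists (fun i j => ball (v i j) (e / 2%:R)) => [i j|w w_e].
    by apply: nbhsx_ballx; rewrite divr_gt0.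
  apply: sub_U; rewrite /f -raddfB -raddfB.
  have -> : e = 2%:R * (e / 2%:R) by rewrite mulrC divfK // pnatr_eq0.
  apply: tsmall_pi => [|i]; first by rewrite divr_gt0.
  rewrite !mxE distrC; exact/ltW/w_e.
have : compact (f @` box).
  by apply: continuous_compact => //; exact: continuous_subspaceT.
congr compact; apply/seteqP; split=> // x _.
have [u <-] := torus_pi_surj x; pose v := \row_i (u i 0 - (Num.floor (u i 0))%:~R).
exists v => [i|].
  rewrite /= mxE in_itv /=; have /andP[] := floor_itv (u i 0).
  by rewrite intrD; lra.
apply/matrixP => i j; rewrite ord1 !mxE; apply/circle_pi_eq.
by rewrite addrAC subrr add0r rpredN intr_int.
Qed.

End TorusTopology.

Section SolenoidTopology.
Variables (R : realType) (n : nat) (M : nzmxseq n).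
Local Notation sol := (solenoid R M).
Implicit Types (x y : sol) (s t : 'cV[R]_n).

Definition stage (k : nat) (x : sol) : 'cV[circle R]_n := val x k.

Lemma stageD k x y : stage k (x + y) = stage k x + stage k y.
Proof. by []. Qed.

Lemma stageB k x y : stage k (x - y) = stage k x - stage k y.
Proof. by []. Qed.

Lemma stageS k x : stage k x = torus_map (M k) (stage k.+1 x).
Proof. by have /asboolP := valP x; apply. Qed.

Lemma stage_inj x y : (forall k, stage k x = stage k y) -> x = y.
Proof. by move=> xy; apply/val_inj/funext. Qed.

Lemma stage_tsmall j k e : (j <= k)%N -> 0 < e ->
  exists2 d, 0 < d & forall x, tsmall d (stage k x) -> tsmall e (stage j x).
Proof.
move=> /subnK <-; elim: (k - j)%N e => [|m IHm] e e_gt0; first by exists e.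
have [d d_gt0 IH] := IHm e e_gt0.
have [d' d'_gt0 Md'] := torus_map_tsmall (M (m + j)) d_gt0.
by exists d' => // x /Md' x_d; apply: IH; rewrite stageS.
Qed.

Lemma nbhs_torus_seq (x : torus_seq R n) k e : 0 < e ->
  nbhs x [set y : torus_seq R n | tsmall e (y k - x k)].
Proof.
move=> e_gt0; have : nbhs (x k) [set z | tsmall e (z - x k)].
  by apply/nbhs_torusP; exists e.
exact: (@proj_continuous nat (fun=> 'cV[circle R]_n) k x).
Qed.

(** One stage suffices for a basis of neighbourhoods, since a stage controls all
    the earlier ones ([stage_tsmall]). *)
Lemma nbhs_solenoidP x (U : set sol) :
  nbhs x U <-> exists k, exists2 e, 0 < e &
                 forall y, tsmall e (stage k (y - x)) -> U y.
Proof.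
split=> [|[k [e e_gt0 sub_U]]]; last first.
  have nbhs_x : nbhs x [set y : sol | tsmall e (stage k (y - x))].
    have := nbhs_torus_seq (val x) k e_gt0.
    exact: (@initial_continuous _ _ (\val : sol -> torus_seq R n) x).
  by apply: filterS nbhs_x => y; exact: sub_U.
move=> [_ [[W Wo <-] Wx] /= WU].
pose level := filter_from [set ke : nat * R | 0 < ke.2]
  (fun ke => [set y | tsmall ke.2 (stage ke.1 (y - x))]).
have level_filter : Filter level.
  apply: filter_from_filter; first by exists (0%N, 1); rewrite /= ltr01.
  move=> [j d] [k e] /= d_gt0 e_gt0.
  have [d' d'_gt0 jd'] := stage_tsmall (leq_maxl j k) d_gt0.
  have [e' e'_gt0 ke'] := stage_tsmall (leq_maxr j k) e_gt0.
  exists (maxn j k, Num.min d' e') => [|y /= y_small].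
    by rewrite /= lt_min d'_gt0.
  by split; [apply: jd'|apply: ke'];
    apply: tsmall_le y_small; rewrite ge_min lexx ?orbT.
have level_cvg : (val : sol -> torus_seq R n) @ level --> (val x : torus_seq R n).
  apply/cvg_sup => i A [_ [[V Vo <-] Vx] /= VA].
  have /nbhs_torusP[e e_gt0 eV] := open_nbhs_nbhs (conj Vo Vx).
  by exists (i, e) => // y y_e; apply: VA; apply: eV.
have [[k e] /= e_gt0 keW] := level_cvg W (open_nbhs_nbhs (conj Wo Wx)).
by exists k; exists e => // y /keW/WU.
Qed.

Lemma torus_seq_compact : compact [set: torus_seq R n].
Proof.
have := @tychonoff nat (fun=> 'cV[circle R]_n) (fun=> setT) (fun=> @torus_compact R n).
by congr compact; apply/seteqP.
Qed.

Lemma in_solenoid_closed : closed [set x : torus_seq R n | in_solenoid M x].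
Proof.
move=> x x_clos; apply/asboolP => j; apply: subr0_eq.
apply/matrixP => i i'; rewrite ord1 [RHS]mxE; apply: small_eq0 => e e_gt0.
have e2_gt0 : 0 < e / 2%:R by rewrite divr_gt0.
have [d d_gt0 Md] := torus_map_tsmall (M j) e2_gt0.
have [y [/asboolP/(_ j) yj [y_e y_d]]] := x_clos _
  (filterI (nbhs_torus_seq x j e2_gt0) (nbhs_torus_seq x j.+1 d_gt0)).
have My : torus_map (M j) (y j.+1 - x j.+1) = y j - torus_map (M j) (x j.+1).
  by rewrite [in RHS]yj; exact: raddfB.
have := smallD (smallN (y_e i)) (Md _ y_d i); rewrite My -splitr.
congr small; rewrite !mxE opprB; exact: subrKA.
Qed.

(** The solenoid is a closed subset of a product of tori; the covering property
    passes from subset to subtype. *)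
Lemma solenoid_compact : compact [set: sol].
Proof.
have sol_compact : compact [set x : torus_seq R n | in_solenoid M x].
  by apply: subclosed_compact in_solenoid_closed torus_seq_compact _.
apply/compact_near_coveringP => I F P FF P_near.
pose P' i (x : torus_seq R n) := forall x_in : in_solenoid M x, P i (exist _ x x_in).
have near_P' (x : torus_seq R n) : in_solenoid M x ->
    \forall x' \near x & i \near F, P' i x'.
  move=> x_in; have [[A B] /= [A_nbhs FB] AB] := P_near (exist _ x x_in) Logic.I.
  have [_ [[W Wo <-] Wx] /= WA] := A_nbhs.
  exists (W, B) => [|[y i] /= [Wy Bi] y_in].
    by split=> //; exact: open_nbhs_nbhs.
  by apply: (AB (exist _ y y_in, i)); split=> //; exact: WA.
have /compact_near_coveringP cover := sol_compact.
have := cover I F P' FF near_P'.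
by apply: filterS => i P'i [x x_in] _; exact: P'i.
Qed.

(** Uniform continuity is the covering property of the compact group applied to
    the translations [u] tending to [0]. *)
Lemma solenoid_unif_cont (f : sol -> circle R) eta : continuous f -> 0 < eta ->
  exists k, exists2 e, 0 < e &
    forall x u, tsmall e (stage k u) -> small eta (f (x + u) - f x).
Proof.
move=> f_cont eta_gt0; have eta2_gt0 : 0 < eta / 2%:R by rewrite divr_gt0.
suff : nbhs (0 : sol) [set u | forall x, small eta (f (x + u) - f x)].
  move=> /nbhs_solenoidP[k [e e_gt0 f_e]]; exists k; exists e => // x u u_e.
  by apply: f_e; rewrite subr0.
have /compact_near_coveringP cover := solenoid_compact.
pose P (u x : sol) := small eta (f (x + u) - f x).
suff P_near (x : sol) : [set: sol] x -> \forall x' \near x & u \near (0 : sol), P u x'.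
  by apply: filterS (cover sol _ P (nbhs_filter (0 : sol)) P_near) => u Pu x; exact: Pu.
move=> _; have /nbhs_solenoidP[k [e e_gt0 f_e]] : nbhs x
    [set y | small (eta / 2%:R) (f y - f x)].
  apply: (f_cont x [set d | small (eta / 2%:R) (d - f x)]).
  by apply/nbhs_circleP; exists (eta / 2%:R).
have e2_gt0 : 0 < e / 2%:R by rewrite divr_gt0.
exists ([set y | tsmall (e / 2%:R) (stage k (y - x))],
        [set u | tsmall (e / 2%:R) (stage k (u - 0))]) => [|[y u] /= [y_e u_e]].
  by split; apply/nbhs_solenoidP; exists k; exists (e / 2%:R).
rewrite /= /P; have fy := f_e y (tsmall_le _ y_e); have fyu := f_e (y + u).
have -> : f (y + u) - f y = (f (y + u) - f x) - (f y - f x).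
  by rewrite subr_cancel.
rewrite [eta]splitr; apply: smallD; last first.
  by apply/smallN/fy; lra.
apply: fyu; have -> : e = e / 2%:R + e / 2%:R by exact: splitr.
by rewrite addrAC stageD; apply: tsmallD => //; rewrite -[u]subr0.
Qed.

End SolenoidTopology.

(** * Lines, characters and endomorphisms of the solenoid *)

Section SolenoidLines.
Variables (R : realType) (n : nat) (M : nzmxseq n).
Local Notation sol := (solenoid R M).
Local Notation pi := (@solenoid_pi R n M).
Implicit Types (x y : sol) (s t : 'cV[R]_n).

Fixpoint pullmx (k : nat) : 'M[R]_n :=
  if k is j.+1 then invmx (map_mx intr (M j)) *m pullmx j else 1%:M.

Lemma pullE k s : pull M k s = pullmx k *m s.
Proof. by elim: k => [|k IHk] /=; rewrite ?mul1mx // IHk mulmxA. Qed.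

Lemma bonding_unit j : map_mx intr (M j) \in @unitmx R n.
Proof. by rewrite unitmxE unitfE det_map_mx intr_eq0 nzmxseq_det. Qed.

Lemma pullmx_unit k : pullmx k \in unitmx.
Proof.
by elim: k => [|k IHk] /=; rewrite ?unitmx1 // unitmx_mul unitmx_inv bonding_unit.
Qed.

Lemma stage_pi k s : stage k (pi s) = torus_pi (pullmx k *m s).
Proof. by rewrite /stage /= pullE. Qed.

Lemma solenoid_piD s t : pi (s + t) = pi s + pi t.
Proof.
by apply: stage_inj => k; rewrite stageD !stage_pi mulmxDr; exact: raddfD.
Qed.

(** Coordinates at the stage [k] of uniform continuity turn the lattice
    [M_1 ... M_k Z^n] into [Z^n], on which [stage k] vanishes. *)
Lemma lin_lift_solenoid (f : sol -> circle R) : continuous f ->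
  exists k (z : 'rV[int]_n), lin_lift (f \o pi) (map_mx intr z *m pullmx k).
Proof.
move=> f_cont; have [|k [e e_gt0 f_k]] := @solenoid_unif_cont _ _ _ f 8%:R^-1 f_cont.
  by rewrite invr_gt0.
pose g := f \o pi \o mulmx (invmx (pullmx k)).
have [|s v|z g_z] := @lin_lift_ex R n g.
- move=> eta eta_gt0; have [j [d d_gt0 f_j]] := solenoid_unif_cont f_cont eta_gt0.
  have d2_gt0 : 0 < d / 2%:R by rewrite divr_gt0.
  have [c c_gt0 Ac] := cube_mulmx (pullmx j *m invmx (pullmx k)) d2_gt0.
  exists c => // s u /Ac u_le; rewrite /g /= mulmxDr solenoid_piD; apply: f_j.
  rewrite stage_pi mulmxA (_ : d = 2%:R * (d / 2%:R)); first exact: tsmall_pi.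
  by rewrite mulrC divfK // pnatr_eq0.
- rewrite /g /= mulmxDr solenoid_piD; apply: f_k => i.
  rewrite stage_pi mulKVmx ?pullmx_unit //.
  suff -> : torus_pi (map_mx intr v) i 0 = 0 :> circle R by exact: small0.
  by rewrite !mxE; apply/circle_pi_eq0; exact: intr_int.
exists k, z; suff <- : g \o mulmx (pullmx k) = f \o pi by exact: lin_lift_comp.
by apply/funext => s; rewrite /g /= mulKmx ?pullmx_unit.
Qed.

(** The one-parameter groups fill each finite stage of the inverse limit. *)
Lemma stage_pi_approx k x :
  exists s, forall j, (j <= k)%N -> stage j (pi s) = stage j x.
Proof.
have [u ux] := torus_pi_surj (stage k x); exists (invmx (pullmx k) *m u) => j.
move=> /subKn <-; elim: (k - j)%N (leq_subr j k) => [_|m IHm lt_mk].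
  by rewrite subn0 stage_pi mulKVmx ?pullmx_unit.
by rewrite [LHS]stageS [RHS]stageS subnSK // IHm // ltnW.
Qed.

(** The image of [pi] is dense and the solenoid is Hausdorff. *)
Lemma continuous_eq_on_lines (Y : nzmxseq n) (h h' : sol -> solenoid R Y) :
  continuous h -> continuous h' -> h \o pi =1 h' \o pi -> h =1 h'.
Proof.
move=> h_cont h'_cont hh' x; apply: stage_inj => j.
apply: subr0_eq; apply/matrixP => i i'; rewrite ord1 [RHS]mxE.
apply: small_eq0 => e e_gt0; have e2_gt0 : 0 < e / 2%:R by rewrite divr_gt0.
have close (f : sol -> solenoid R Y) : continuous f -> exists k, exists2 d, 0 < d &
    forall y, tsmall d (stage k (y - x)) -> tsmall (e / 2%:R) (stage j (f y - f x)).
  move=> f_cont; apply/(nbhs_solenoidP x [set y | tsmall _ (stage j (f y - f x))]).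
  apply: (f_cont x [set z | tsmall (e / 2%:R) (stage j (z - f x))]).
  by apply/nbhs_solenoidP; exists j; exists (e / 2%:R).
have [k [d d_gt0 h_d]] := close h h_cont.
have [k' [d' d'_gt0 h'_d']] := close h' h'_cont.
have [s sx] := stage_pi_approx (maxn k k') x.
have zero_small c m : 0 < c -> (m <= maxn k k')%N -> tsmall c (stage m (pi s - x)).
  move=> c_gt0 le_m i'' ; rewrite stageB sx // mxE [X in _ + X]mxE subrr.
  exact: small0.
have hs := h_d _ (zero_small _ _ d_gt0 (leq_maxl _ _)).
have h's := h'_d' _ (zero_small _ _ d'_gt0 (leq_maxr _ _)).
have := smallD (smallN (hs i)) (h's i); rewrite -splitr.
congr small; have := hh' s => /= ->; rewrite !stageB !mxE opprB; exact: subrKA.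
Qed.

(** For every stage [j], [A] maps the lattice of some stage [k] into the lattice
    of stage [j], and so induces a homomorphism between the two tori. *)
Definition stage_integral (A : 'M[R]_n) := forall j, exists k (N : 'M[int]_n),
  map_mx intr N *m pullmx k = pullmx j *m A.

(** Stage [j] of the endomorphism is read off from stage [k j] through the
    integer matrix [N j]; the compatibility of the stages holds on the image of
    [pi], which agrees with any given point up to a finite stage. *)
Lemma solenoid_end (A : 'M[R]_n) : stage_integral A ->
  exists h : sol -> sol, [/\ zmod_morphism h, continuous h &
    h \o pi =1 pi \o mulmx A].
Proof.
move=> /choice[k /choice[N NP]].
pose hc x j := torus_map (N j) (stage (k j) x).
have hc_pi s j : hc (pi s) j = torus_pi (pullmx j *m (A *m s)).
  by rewrite /hc stage_pi torus_mapE !mulmxA NP.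
have hc_in x : in_solenoid M (hc x : torus_seq R n).
  apply/asboolP => j; have [s sx] := stage_pi_approx (maxn (k j) (k j.+1)) x.
  have hcs i : (k i <= maxn (k j) (k j.+1))%N -> hc x i = hc (pi s) i.
    by move=> le_i; rewrite /hc sx.
  rewrite !hcs ?leq_maxl ?leq_maxr // !hc_pi torus_mapE /= -mulmxA.
  by rewrite mulKVmx ?bonding_unit.
pose h x : sol := exist _ (hc x : torus_seq R n) (hc_in x).
have hB : zmod_morphism h.
  by move=> x y; apply: stage_inj => j; exact: (raddfB (torus_map (N j))).
exists h; split=> // [x U /nbhs_solenoidP[j [e e_gt0 sub_U]]|s]; last first.
  by apply: stage_inj => j; rewrite [RHS]stage_pi; exact: hc_pi.
have [d d_gt0 Nd] := torus_map_tsmall (N j) e_gt0.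
apply/nbhs_solenoidP; exists (k j); exists d => // y /Nd y_e.
by apply: sub_U; rewrite -hB.
Qed.

Lemma solenoid_aut (A B : 'M[R]_n) : A *m B = 1%:M ->
  stage_integral A -> stage_integral B -> exists h, represents (M := M) A h.
Proof.
move=> AB1 /solenoid_end[h [hB h_cont h_pi]] /solenoid_end[h' [_ h'_cont h'_pi]].
have BA1 := mulmx1C AB1.
exists h; split=> //; split=> //; exists h'; split=> // x.
  apply: (continuous_eq_on_lines (h := h' \o h) (h' := id)) => [y|y|s /=].
  - by apply: continuous_comp; [exact: h_cont|exact: h'_cont].
  - exact: cvg_id.
  by have /= -> := h_pi s; have /= -> := h'_pi (A *m s); rewrite mulmxA BA1 mul1mx.
apply: (continuous_eq_on_lines (h := h \o h') (h' := id)) => [y|y|s /=].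
- by apply: continuous_comp; [exact: h'_cont|exact: h_cont].
- exact: cvg_id.
by have /= -> := h'_pi s; have /= -> := h_pi (B *m s); rewrite mulmxA AB1 mul1mx.
Qed.

End SolenoidLines.

Lemma zmod_morphismD (U V : zmodType) (f : U -> V) :
  zmod_morphism f -> {morph f : x y / x + y}.
Proof.
move=> fB; pose F : {additive U -> V} :=
  HB.pack f (GRing.isZmodMorphism.Build _ _ f fB).
exact: (raddfD F).
Qed.

(** * Multiplication by a number between one-dimensional solenoids *)

Section Multiplication.
Variable R : realType.
Implicit Types P Q : nzseq.

Definition zprod P j : int := \prod_(i < j) P i.

Lemma zprodS P j : zprod P j.+1 = zprod P j * P j.
Proof. by rewrite /zprod big_ord_recr. Qed.

Lemma zprod_neq0 P j : zprod P j != 0.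
Proof. by apply/prodf_neq0 => i _; exact: nzseq_neq0. Qed.

Lemma zprodR_neq0 P j : (zprod P j)%:~R != 0 :> R.
Proof. by rewrite intr_eq0 zprod_neq0. Qed.

Lemma abs_zprod P j : `|zprod P j|%N = pprod P j.
Proof.
elim: j => [|j IHj]; first by rewrite /zprod /pprod !big_ord0.
by rewrite zprodS pprodS abszM IHj.
Qed.

Lemma zprod_multiple P j k : (j <= k)%N -> exists m : int, zprod P k = zprod P j * m.
Proof.
move=> /subnK <-; elim: (k - j)%N => [|i [m IH]]; first by exists 1; rewrite mulr1.
by exists (m * P (i + j)%N); rewrite addSn zprodS IH mulrA.
Qed.

(** With [Z[1/P]] the group of the fractions [z / (p_1 ... p_k)], the dual of
    the solenoid of [P], this says that [b Z[1/P]] is contained in [Z[1/Q]]. *)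
Definition transfers P Q (b : R) := forall j, exists k (z : int),
  b * (zprod Q k)%:~R = z%:~R * (zprod P j)%:~R.

Lemma transfers_after P Q b j : transfers P Q b -> exists k0, forall k,
  (k0 <= k)%N -> exists z : int, b * (zprod Q k)%:~R = z%:~R * (zprod P j)%:~R.
Proof.
move=> /(_ j)[k0 [z bz]]; exists k0 => k /(zprod_multiple Q)[m ->].
by exists (z * m); rewrite !intrM mulrA bz mulrAC.
Qed.

(** If [b = z0 / (q_1 ... q_k0)], then [p_1 ... p_j] divides the product of [z0]
    and some [q_1 ... q_k]. *)
Lemma transfers_seq_le P Q b : transfers P Q b -> b != 0 -> seq_le P Q.
Proof.
move=> b_PQ b_neq0; have [k0 [z0]] := b_PQ 0%N.
rewrite {2}/zprod big_ord0 mulr1 => bz0.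
apply: (@seq_le_of_dvdn P Q `|z0|%N) => [|j].
  rewrite absz_gt0 -(intr_eq0 R) -bz0 mulf_neq0 //; exact: zprodR_neq0.
have [k [z bz]] := b_PQ j; exists k.
have z0k : z0 * zprod Q k = zprod P j * (z * zprod Q k0).
  apply: (@intr_inj R); rewrite !intrM -bz0 mulrAC bz.
  by rewrite [RHS]mulrCA mulrA.
by rewrite -!abs_zprod -abszM z0k abszM dvdn_mulr.
Qed.

Lemma transfers1 P : transfers P P 1.
Proof. by move=> j; exists j, 1. Qed.

Lemma pullmx_scal1 P k :
  pullmx R (scal1_seq P) k = ((zprod P k)%:~R^-1)%:M :> 'M[R]_1.
Proof.
elim: k => [|k IHk] /=; first by rewrite /zprod big_ord0 invr1.
apply: (can_inj (mulKmx (bonding_unit R (scal1_seq P) k))).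
rewrite mulKVmx ?bonding_unit // IHk /= map_scalar_mx -scalar_mxM.
congr (_%:M); rewrite zprodS intrM invfM mulrCA divff ?mulr1 //.
by rewrite intr_eq0 nzseq_neq0.
Qed.

Lemma stage_integral_scal P a : transfers P P a ->
  stage_integral (scal1_seq P) (a%:M : 'M[R]_1).
Proof.
move=> a_P j; have [k [z az]] := a_P j; exists k, z%:M.
rewrite !pullmx_scal1 map_scalar_mx -!scalar_mxM; congr (_%:M).
apply: (canLR (mulfK (zprodR_neq0 P k))).
by rewrite -mulrA az mulrCA mulVf ?mulr1 // zprodR_neq0.
Qed.

(** On the path component the multiplier agrees with the endomorphism of the
    whole solenoid induced by [a]: as [param_dom P] is the whole real line,
    [xget] does select a preimage, and every preimage gives the same value. *)
Lemma proper_multiplier_of_transfers P a : (forall N, ~ one_from P N) ->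
  transfers P P a -> proper_multiplier P P a.
Proof.
move=> P_inf /stage_integral_scal/solenoid_end[h [hB h_cont h_pi]].
have mult_h : {in path_comp P, multiplier P P a =1 h}.
  move=> x /set_mem[s _ sx]; rewrite /multiplier.
  set t := xget 0 _.
  have [_ tx] : [set s | param_dom P s /\ sol1_pi P s = x] t.
    by apply: (@xgetI _ _ _ s); split=> // N /P_inf.
  rewrite -tx /sol1_pi; have /= -> := h_pi (const_mx t).
  by congr solenoid_pi; apply/matrixP => i i'; rewrite mul_scalar_mx !mxE.
split.
  apply: (subspace_eq_continuous (f := h)) => [x x_in|]; first exact/esym/mult_h.
  exact: continuous_subspaceT.
move=> x y x_in y_in; rewrite !mult_h //; first exact: zmod_morphismD.
have [s _ <-] := set_mem x_in; have [t _ <-] := set_mem y_in.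
apply/mem_set; exists (s + t) => //; rewrite /sol1_pi -solenoid_piD.
by congr solenoid_pi; apply/matrixP => i i'; rewrite !mxE.
Qed.

End Multiplication.

(** [n * alpha t = alpha (n * t)] lies between the values of [alpha] at the two
    integers around [n * t], hence within [alpha 1] of [n * t * alpha 1]. *)
Lemma increasing_additive_linear (R : realType) (alpha : R -> R) :
  zmod_morphism alpha -> {homo alpha : s t / s < t} ->
  forall t, alpha t = t * alpha 1.
Proof.
move=> alphaB alpha_lt t; pose f : {additive R -> R} :=
  HB.pack alpha (GRing.isZmodMorphism.Build _ _ alpha alphaB).
have alpha_int (m : int) : alpha m%:~R = m%:~R * alpha 1.
  by rewrite -[LHS]/(f _) raddfMz mulrzl.
have alpha_le : {homo alpha : s t / s <= t} by apply: ltW_homo.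
have near_linear n : n%:R * `|alpha t - t * alpha 1| <= alpha 1.
  have alpha_nt : alpha (n%:R * t) = n%:R * alpha t.
    by rewrite -[LHS]/(f _) mulr_natl raddfMn mulr_natl.
  have /andP[le_nt /ltW nt_le] := floor_itv (n%:R * t).
  have := alpha_le _ _ le_nt; have := alpha_le _ _ nt_le.
  have alpha1_gt0 : 0 < alpha 1.
    by have := alpha_lt _ _ ltr01; rewrite -[alpha 0]/(f 0) raddf0.
  move: (ler_wpM2r (ltW alpha1_gt0) le_nt) (ler_wpM2r (ltW alpha1_gt0) nt_le).
  rewrite !alpha_int alpha_nt intrD mulrDl mul1r.
  rewrite -[X in X * `|_|](ger0_norm (ler0n R n)) -normrM mulrBr mulrA ler_norml.
  by lra.
apply/eqP; rewrite -subr_eq0 -normr_eq0; apply: contraT => d_neq0.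
set d := `|_| in near_linear d_neq0.
have d_gt0 : 0 < d by rewrite lt0r d_neq0 /d normr_ge0.
have := near_linear (Num.bound (alpha 1 / d)); rewrite -ler_pdivlMr // leNgt.
rewrite archi_boundP // divr_ge0 ?(ltW d_gt0) //.
by apply: le_trans (near_linear 0%N); rewrite mul0r.
Qed.

(** * The diagonal solenoid and its linear flows *)

Section DiagonalSolenoid.
Variables (R : realType) (P Q : nzseq).
Local Notation D := (diag2_seq P Q).
Local Notation T := (pair_seq P Q).
Local Notation pi := (@solenoid_pi R 2 D).

Lemma diag2_seqE j : diag2 (P j) (Q j) = diag_mx (\row_i T i j).
Proof.
congr diag_mx; apply/matrixP => i i'; rewrite !mxE.
by case: i' => [[|[|m]] ltm2] //; rewrite /pair_seq (tnth_nth P).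
Qed.

Lemma pullmx_diag2 k :
  pullmx R D k = diag_mx (\row_i (zprod (T i) k)%:~R^-1).
Proof.
elim: k => [|k IHk] /=.
  rewrite -diag_const_mx; congr diag_mx.
  by apply/matrixP => i i'; rewrite !mxE /zprod big_ord0 invr1.
apply: (can_inj (mulKmx (bonding_unit R D k))).
rewrite mulKVmx ?bonding_unit // IHk /= diag2_seqE map_diag_mx mulmx_diag.
congr diag_mx; apply/matrixP => i i'; rewrite !mxE.
by rewrite zprodS intrM invfM mulrCA divff ?mulr1 // intr_eq0 nzseq_neq0.
Qed.

Lemma stage_diag2S j (x : solenoid R D) i :
  stage j x i 0 = stage j.+1 x i 0 *~ T i j.
Proof.
rewrite stageS mxE (bigD1 i) //= big1 ?addr0 => [|m m_neq_i]; last first.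
  by rewrite diag2_seqE !mxE eq_sym (negPf m_neq_i) mulr0z.
by rewrite diag2_seqE !mxE eqxx.
Qed.

(** [l] is the linear form of the coordinate [i] of [h] at stage [0]. Along the
    flow line of [w] this coordinate is affine of slope [c w'_i]; and [l] is a
    multiple of the form at stage [j], which is integral at some stage [k]. *)
Lemma flow_character (w w' : 'cV[R]_2) (c : R) (h : solenoid R D -> solenoid R D) i :
  continuous h ->
  (forall t x, h (linear_flow w t x) = linear_flow w' (c * t) (h x)) ->
  exists l : 'rV[R]_2, (l *m w) 0 0 = c * w' i 0 /\
    forall m, transfers (T i) (T m) (l 0 m).
Proof.
move=> h_cont h_flow; pose f j x := stage j (h x) i 0.
have f_cont j : continuous (f j).
  move=> x U /nbhs_circleP[e e_gt0 sub_U].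
  have nbhs_x : nbhs x [set y | tsmall e (stage j (h y - h x))].
    apply: (h_cont x [set y | tsmall e (stage j (y - h x))]).
    by apply/nbhs_solenoidP; exists j; exists e.
  apply: filterS nbhs_x => y y_e; apply: sub_U.
  by have := y_e i; rewrite stageB !mxE.
have /choice[k /choice[z z_lift]] j := lin_lift_solenoid (f_cont j).
pose l j := map_mx intr (z j) *m pullmx R D (k j).
have l_step j : l j = (T i j)%:~R *: l j.+1.
  apply: (lin_lift_unique (z_lift j) (lin_lift_mulz (T i j) (z_lift j.+1))).
  by move=> s; rewrite /= /f stage_diag2S; exact: subrr.
have l0 j : l 0%N = (zprod (T i) j)%:~R *: l j.
  elim: j => [|j IHj]; first by rewrite /zprod big_ord0 scale1r.
  by rewrite IHj {1}l_step scalerA -intrM zprodS.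
exists (l 0%N); split=> [|m j]; last first.
  exists (k j), (z j 0 m); rewrite (l0 j) /l pullmx_diag2 mul_mx_diag !mxE.
  by rewrite mulrA mulfVK ?zprodR_neq0 // mulrC.
have l_kappa : l 0%N *m w = (c * w' i 0)%:M.
  apply: (lin_lift_unique (lin_lift_comp w (z_lift 0%N))
           (lin_lift_affine (c * w' i 0)%:M (stage 0 (h 0) i 0)) (c := 0)) => s.
  rewrite /= /f.
  have -> : w *m s = s 0 0 *: w.
    by apply/matrixP => m m'; rewrite !ord1 !mxE big_ord1 mulrC.
  have -> : pi (s 0 0 *: w) = linear_flow w (s 0 0) 0 by rewrite /linear_flow addr0.
  suff -> : stage 0 (h (linear_flow w (s 0 0) 0)) i 0 =
      circle_pi (((c * w' i 0)%:M *m s) 0 0) + stage 0 (h 0) i 0 by exact: subrr.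
  rewrite h_flow /linear_flow stageD [LHS]mxE stage_pi mul1mx; congr (_ + _).
  by rewrite mxE mul_scalar_mx !mxE; congr circle_pi; ring.
by rewrite l_kappa mxE eqxx.
Qed.

(** Incomparability leaves in the form of [flow_character] only the entry [i],
    since the other one would transfer [P] to [Q] or [Q] to [P]. *)
Lemma flow_transfer (w w' : 'cV[R]_2) (c : R) (h : solenoid R D -> solenoid R D) i :
  ~ seq_le P Q -> ~ seq_le Q P -> continuous h ->
  (forall t x, h (linear_flow w t x) = linear_flow w' (c * t) (h x)) ->
  exists2 a : R, transfers (T i) (T i) a & a * w i 0 = c * w' i 0.
Proof.
move=> nlePQ nleQP h_cont h_flow.
have incomparable j m : m != j -> ~ seq_le (T j) (T m).
  rewrite /pair_seq !(tnth_nth P).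
  by case: j m => [[|[|j]] ?] // [[|[|m]] ?].
have [l [lw l_T]] := flow_character i h_cont h_flow.
exists (l 0 i) => //; rewrite -lw mxE (bigD1 i) //= big1 ?addr0 // => m m_neq_i.
suff -> : l 0 m = 0 by rewrite mul0r.
apply/eqP; apply: contraT => /(transfers_seq_le (l_T m)) le_im.
by case: (incomparable i m m_neq_i).
Qed.

Lemma stage_integral_diag2 a d : transfers P P a -> transfers Q Q d ->
  stage_integral D (diag2 a d : 'M[R]_2).
Proof.
move=> a_P d_Q j; have [k aP] := transfers_after j a_P.
have [k' dQ] := transfers_after j d_Q.
have [z az] := aP _ (leq_maxl k k'); have [z' dz'] := dQ _ (leq_maxr k k').
exists (maxn k k'), (diag2 z z'); rewrite !pullmx_diag2 map_diag_mx !mulmx_diag.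
congr diag_mx; apply/matrixP => i i'; rewrite !mxE.
have quot T' b y k0 : b * (zprod T' k0)%:~R = y%:~R * (zprod T' j)%:~R :> R ->
    y%:~R / (zprod T' k0)%:~R = (zprod T' j)%:~R^-1 * b.
  move=> by_; apply: (canLR (mulfK (zprodR_neq0 R T' k0))).
  by rewrite -mulrA by_ mulrCA mulVf ?mulr1 // zprodR_neq0.
by case: i' => [[|[|m]] ltm2] //; rewrite /pair_seq !(tnth_nth P) /=; apply: quot.
Qed.

Lemma diag2_inv (a d : R) : a != 0 -> d != 0 -> diag2 a d *m diag2 a^-1 d^-1 = 1%:M.
Proof.
move=> a_neq0 d_neq0; rewrite mulmx_diag -diag_const_mx; congr diag_mx.
apply/matrixP => i i'; rewrite !mxE.
by case: i' => [[|[|m]] ltm2] //=; rewrite divff.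
Qed.

End DiagonalSolenoid.

(** The case [x = 0] has to be separated: then [a] and [b] need not be inverse
    to each other, but [y = 0] and the factor [1] does what is asked. *)
Lemma iso_transfers (R : realType) (P : nzseq) (a b x y : R) :
  transfers P P a -> transfers P P b -> a * x = y -> b * y = x ->
  exists e : R, [/\ e != 0, transfers P P e, transfers P P e^-1 & e * x = y].
Proof.
move=> a_P b_P ax by_; have [x0|x_neq0] := eqVneq x 0.
  exists 1; rewrite oner_neq0 invr1 mul1r; split=> //; try exact: transfers1.
  by rewrite -ax x0 mulr0.
have ba1 : b * a = 1 by apply: (mulIf x_neq0); rewrite mul1r -mulrA ax.
have a_neq0 : a != 0.
  by apply: contra_eq_neq ba1 => ->; rewrite mulr0 eq_sym oner_neq0.
have a_inv : a^-1 = b by apply: (mulIf a_neq0); rewrite ba1 mulVf.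
by exists a; rewrite a_inv.
Qed.

Theorem corollary11 (R : realType) (P Q : nzseq)
  (arrPQ : properly_arranged (pair_seq P Q))
  (nlePQ : ~ seq_le P Q) (nleQP : ~ seq_le Q P)
  (w w' : 'cV[R]_2) (w_neq0 : w != 0) (w'_neq0 : w' != 0) :
  flows_equivalent (linear_flow (M := diag2_seq P Q) w)
                   (linear_flow (M := diag2_seq P Q) w') ->
  exists a d : R,
    [/\ iso_multiplier P a, iso_multiplier Q d &
      exists h : solenoid R (diag2_seq P Q) -> solenoid R (diag2_seq P Q),
        represents (diag2 a d) h /\
        exists alpha : R -> R,
          flow_equivalence (linear_flow (M := diag2_seq P Q) w)
                           (linear_flow (M := diag2_seq P Q) w') alpha h].
Proof.
move=> [alpha [h [alphaB alpha_cont alpha_lt]]].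
move=> [g [hK gK h_cont g_cont]] h_flow.
have alphaE := increasing_additive_linear alphaB alpha_lt.
set c := alpha 1 in alphaE.
have c_gt0 : 0 < c.
  by have := alpha_lt _ _ (@ltr01 R); rewrite alphaE mul0r.
have c_neq0 : c != 0 by rewrite gt_eqF.
have {}h_flow t x : h (linear_flow w t x) = linear_flow w' (c * t) (h x).
  by rewrite h_flow alphaE mulrC.
have g_flow t x : g (linear_flow w' t x) = linear_flow w (c^-1 * t) (g x).
  apply: (can_inj hK); rewrite gK h_flow gK mulrA divff // mul1r //.
have iso i : exists e : R, [/\ e != 0, transfers (pair_seq P Q i) (pair_seq P Q i) e,
    transfers (pair_seq P Q i) (pair_seq P Q i) e^-1 & e * w i 0 = c * w' i 0].
  have [a a_T aw] := flow_transfer i nlePQ nleQP h_cont h_flow.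
  have [b b_T bw'] := flow_transfer i nlePQ nleQP g_cont g_flow.
  apply: (iso_transfers a_T b_T aw); rewrite mulrCA bw' mulrA divff //.
  by rewrite mul1r.
have [a [a_neq0]] := iso 0; rewrite -[pair_seq P Q 0]/P => a_P aV_P aw.
have [d [d_neq0]] := iso 1; rewrite -[pair_seq P Q 1]/Q => d_Q dV_Q dw.
have adw (i : 'I_2) : [:: a; d]`_i * w i 0 = c * w' i 0.
  by case: i => [[|[|m]] ltm2] //=; [rewrite (_ : Ordinal _ = 0)|
    rewrite (_ : Ordinal _ = 1)] => //; exact: val_inj.
have P_inf N : ~ one_from P N by move=> /(one_from_seq_le Q).
have Q_inf N : ~ one_from Q N by move=> /(one_from_seq_le P).
exists a, d; split.
- by split=> //; exact: proper_multiplier_of_transfers.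
- by split=> //; exact: proper_multiplier_of_transfers.
have [A A_rep] := solenoid_aut (diag2_inv a_neq0 d_neq0)
  (stage_integral_diag2 a_P d_Q) (stage_integral_diag2 aV_P dV_Q).
exists A; split=> //; exists alpha; have [[A_B A_homeo] A_pi] := A_rep.
split=> // t x; rewrite /linear_flow (zmod_morphismD A_B); congr (_ + _).
have /= -> := A_pi (t *: w); congr solenoid_pi; rewrite alphaE.
apply/matrixP => i i'; rewrite ord1 mul_diag_mx !mxE.
by rewrite mulrCA adw mulrA.
Qed.
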